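(* Let $(X,d)$ be a (nonempty) complete separable metric space, and let $\mathcal{K}(X)$ be the set of nonempty compact subsets of $X$ equipped with the Hausdorff metric $d_H$. Schmidt's game is played on the complete metric space $(\mathcal{K}(X),d_H)$. Then: (i) If $X$ is uniformly perfect, then the set $\{K\in\mathcal{K}(X) : \dim_L K>0\}$ is winning. (ii) For all $\varepsilon>0$, the set $\{K\in\mathcal{K}(X) : \dim_L K<\dim_L X-\varepsilon\}$ is not winning. (iii) If $X$ is Assouad sharp, then the set $\{K\in\mathcal{K}(X) : \dim_A K<\dim_A X\}$ is winning. (iv) If $X$ is doubling, then for all $\varepsilon>0$ the set $\{K\in\mathcal{K}(X) : \dim_A K>\varepsilon\}$ is not winning.
   Context: **Schmidt's game.** Let $(Y,\rho)$ be a complete metric space and $0<\alpha,\beta<1$. The $(\alpha,\beta)$-game between Alice and Bob: Bob first chooses $r_0>0$ and $x_0\in Y$. Put $r_n=(\alpha\beta)^n r_0$. For $n=1,2,\dots$: Alice chooses $y_n\in Y$ with $\rho(x_{n-1},y_n)+\alpha r_{n-1}\le r_{n-1}$; then Bob chooses $x_n\in Y$ with $\rho(y_n,x_n)+\alpha\beta r_{n-1}\le \alpha r_{n-1}$. The closed balls $B_n=B(x_n,r_n)$ and $A_n=B(y_n,\alpha r_{n-1})$ satisfy $B_0\supseteq A_1\supseteq B_1\supseteq A_2\supseteq\cdots$ and intersect in a unique point, called the outcome. A set $S\subseteq Y$ is $(\alpha,\beta)$-winning if Alice has a strategy guaranteeing that the outcome lies in $S$; it is $\alpha$-winning if it is $(\alpha,\beta)$-winning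 for all $0<\beta<1$; it is winning if it is $\alpha$-winning for some $0<\alpha<1$. **Dimensions.** For a subset $K$ of a metric space, $N_r(K)$ denotes the minimal number of open sets of diameter at most $r$ required to cover $K$; $B(x,R)$ is the closed ball. For nonempty $K$: - The Assouad dimension $\dim_A K$ is the infimum of all $s\ge 0$ for which there is a constant $C>0$ such that for all $0<r<R$ and all $x\in K$, $N_r(B(x,R)\cap K)\le C(R/r)^s$ ($\dim_A K=\infty$ if there is no such $s$). - The lower dimension $\dim_L K$ is the supremum of all $s\ge 0$ for which there is a constant $C>0$ such that for all $0<r<R\le\max\{\mathrm{diam}(K),1\}$ and all $x\in K$, $N_r(B(x,R)\cap K)\ge C(R/r)^s$. **Properties of $X$.** $X$ is doubling if $\dim_A X<\infty$. $X$ is uniformly perfect if $\dim_L X>0$. $X$ is Assouad sharp if it is doubling and there exists $C>0$ such that $N_r(B(x,R))\le C(R/r)^{\dim_A X}$ for all $x\in X$ and $0<r<R$.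
   Formalization: Part (iii) assumes dim_A X > 0, since for dim_A X = 0 (e.g. a one-point X) the set is empty and not winning; in part (ii), if dim_L X = ∞, ''dim_L X − ε'' is replaced by an arbitrary real number s. *)

(* Defs.v *)
From HB Require Import structures.
From mathcomp Require Import all_boot all_order all_algebra.
From mathcomp Require Import all_classical all_reals all_analysis.

Set Implicit Arguments.
Unset Strict Implicit.
Unset Printing Implicit Defensive.

Import Order.TTheory GRing.Theory Num.Theory.

Local Open Scope classical_set_scope.
Local Open Scope ring_scope.

(* [Complete] includes a distinguished point, so these spaces are nonempty. *)
#[short(type="completeMetricType")]
HB.structure Definition CompleteMetric (R : numDomainType) :=
  {T of Complete T & Metric R T}.

Definition separable (T : topologicalType) : Prop :=
  exists2 D : set T, countable D & dense D.

(* Not the library's [closed_ball], which is the closure of the open ball. *)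
Definition cball (R : realType) (Y : metricType R) (x : Y) (r : R) : set Y :=
  [set y | mdist x y <= r].

(* The diameter of the empty set is -oo here. *)
Definition diam (R : realType) (Y : metricType R) (A : set Y) : \bar R :=
  ereal_sup [set (mdist p.1 p.2)%:E | p in A `*` A].

Section hyperspace.
Context {R : realType} (X : metricType R).
Implicit Types (A B : set X) (x y : X) (e : R).

Record compacts : Type := Compacts {
  cset :> set X ;
  cset_compact : compact cset ;
  cset_nonempty : cset !=set0 }.

Definition cthickening e A : set X :=
  [set x | exists2 a, A a & mdist x a <= e].

Definition hausdorff_radii A B : set R :=
  [set e | [/\ 0 <= e, A `<=` cthickening e B & B `<=` cthickening e A]].

Definition hausdorff_dist A B : R := inf (hausdorff_radii A B).

Let radii_lbound A B : has_lbound (hausdorff_radii A B).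
Proof. by exists 0 => e []. Qed.

Let compact_bounded_from A x : compact A -> exists M, A `<=` cball x M.
Proof.
move=> cA; apply: contrapT => /forallNP unbA.
pose F := filter_from setT (fun n : nat => A `&` [set a | n%:R < mdist x a]).
have FF : Filter F.
  apply: filter_from_filter; first by exists 0%N.
  move=> i j _ _; exists (maxn i j) => // a [Aa /= ija].
  by split; split=> //=; apply: le_lt_trans ija;
    rewrite ler_nat ?leq_maxl ?leq_maxr.
have PF : ProperFilter F.
  apply: filter_from_proper => n _.
  have /existsNP[a /not_implyP[Aa /= /negP]] := unbA n%:R.
  by rewrite -ltNge => na; exists a.
have FA : F A by exists 0%N => // a [].
have [p [Ap clFp]] := cA F PF FA.
pose n := (Num.truncn (mdist x p + 1)).+1.
have Fn : F (A `&` [set a | n%:R < mdist x a]) by exists n.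
have [a [[Aa /= na] /=]] := clFp _ _ Fn (nbhsx_ballx p 1 ltr01).
rewrite ballEmdist /= => pa.
have := lt_trans (truncnS_gt (mdist x p + 1)) na.
by rewrite ltNge (le_trans (metric_triangle x p a))// lerD2l ltW.
Qed.

Let radii_has_inf (A B : compacts) : has_inf (hausdorff_radii A B).
Proof.
split; last exact: radii_lbound.
have [a Aa] := cset_nonempty A; have [b Bb] := cset_nonempty B.
have [M AM] := compact_bounded_from b (@cset_compact A).
have [N BN] := compact_bounded_from a (@cset_compact B).
have M0 : 0 <= M by apply: le_trans (AM _ Aa); exact: mdist_ge0.
have N0 : 0 <= N by apply: le_trans (BN _ Bb); exact: mdist_ge0.
exists (M + N); split; first exact: addr_ge0.
- move=> x Ax; exists b => //; rewrite metric_sym.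
  by rewrite (le_trans (AM _ Ax))// lerDl.
- move=> x Bx; exists a => //; rewrite metric_sym.
  by rewrite (le_trans (BN _ Bx))// lerDr.
Qed.

Let hausdorff_distxx (A : compacts) : hausdorff_dist A A = 0.
Proof.
apply/eqP; rewrite eq_le; apply/andP; split.
  apply: ge_inf; first exact: radii_lbound.
  by split=> // x Ax; exists x => //; rewrite mdistxx.
by apply: lb_le_inf; [exact: (radii_has_inf A A).1 | move=> e []].
Qed.

Let hausdorff_dist_sym (A B : compacts) :
  hausdorff_dist A B = hausdorff_dist B A.
Proof.
by congr inf; apply/seteqP; split=> e [].
Qed.

Let hausdorff_dist0_sub (A B : compacts) : hausdorff_dist A B = 0 -> A `<=` B.
Proof.
move=> AB0 x Ax.
have /closure_id -> : closed B.
  by apply: compact_closed (@cset_compact B); exact: metric_hausdorff.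
move=> U /nbhs_ballP[e /= e0 xeU].
have [d [d0 AdB _]] := inf_adherent e0 (radii_has_inf A B).
rewrite [inf _]AB0 add0r => de.
have [b Bb xb] := AdB _ Ax; exists b; split=> //; apply: xeU.
by rewrite ballEmdist /= (le_lt_trans xb).
Qed.

Let hausdorff_dist_positivity (A B : compacts) :
  hausdorff_dist A B = 0 -> A = B.
Proof.
move=> AB0.
have : cset A = cset B.
  apply/seteqP; split; apply: hausdorff_dist0_sub => //.
  by rewrite hausdorff_dist_sym.
case: A B {AB0} => A cA A0 [B cB B0] /= AB; case: _ / AB in cB B0 *.
by congr Compacts; exact: Prop_irrelevance.
Qed.

Let hausdorff_dist_triangle (B A C : compacts) :
  hausdorff_dist A C <= hausdorff_dist A B + hausdorff_dist B C.
Proof.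
apply/ler_addgt0Pl => e e0.
have e20 : 0 < e / 2 by rewrite divr_gt0.
have [d [d0 AdB BdA] dAB] := inf_adherent e20 (radii_has_inf A B).
have [f [f0 BfC CfB] fBC] := inf_adherent e20 (radii_has_inf B C).
apply: (@le_trans _ _ (d + f)).
  apply: ge_inf; first exact: radii_lbound.
  split; first exact: addr_ge0.
  - move=> x /AdB[b /BfC[c Cc bc] xb]; exists c => //.
    by rewrite (le_trans (metric_triangle x b c))// lerD.
  - move=> x /CfB[b /BdA[a Aa ba] xb]; exists a => //.
    by rewrite (le_trans (metric_triangle x b a))// addrC lerD.
rewrite [e]splitr addrACA [e / 2 + _]addrC [e / 2 + _]addrC.
by rewrite lerD// ltW.
Qed.

HB.instance Definition _ := gen_eqMixin compacts.
HB.instance Definition _ := gen_choiceMixin compacts.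
HB.instance Definition _ := @isMetric.Build R compacts
  (fun A B : compacts => hausdorff_dist A B)
  hausdorff_distxx hausdorff_dist_positivity
  hausdorff_dist_sym hausdorff_dist_triangle.

Lemma mdist_compactsE (A B : compacts) : mdist A B = hausdorff_dist A B.
Proof. by []. Qed.

End hyperspace.

Section schmidt_game.
Context {R : realType} {Y : metricType R}.

(* A strategy of Alice maps r_0 and Bob's centers x_0, ..., x_{n-1} to her n-th
   center y_n; her own earlier moves are determined by these data.  It is enough
   to consider infinite plays in which Bob always obeys the rules: whatever y_n
   is, x_n = y_n is allowed, so any finite such play extends to an infinite
   one. *)
Definition ab_winning (alpha beta : R) (S : set Y) : Prop :=
  exists sigma : R -> seq Y -> Y, forall (r0 : R) (x : nat -> Y),
    let r n := (alpha * beta) ^+ n * r0 in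
    let y n := sigma r0 (mkseq x n) in
    0 < r0 ->
    (forall n, mdist (y n.+1) (x n.+1) + alpha * beta * r n <= alpha * r n) ->
    (forall n, mdist (x n) (y n.+1) + alpha * r n <= r n) /\
    exists2 p, S p &
      \bigcap_n (cball (x n) (r n) `&` cball (y n.+1) (alpha * r n)) = [set p].

Definition alpha_winning (alpha : R) (S : set Y) : Prop :=
  forall beta, 0 < beta < 1 -> ab_winning alpha beta S.

Definition winning (S : set Y) : Prop :=
  exists2 alpha, 0 < alpha < 1 & alpha_winning alpha S.

End schmidt_game.

Section dimensions.
Context {R : realType} {X : metricType R}.
Implicit Type K : set X.

(* +oo if there is no finite cover. *)
Definition cover_number (r : R) K : \bar R :=
  ereal_inf [set n%:R%:E | n in [set n : nat | exists U : 'I_n -> set X,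
    (forall i, open (U i) /\ (diam (U i) <= r%:E)%E) /\
    K `<=` \bigcup_i U i]].

Definition assouad_dim_bound K (s : R) : Prop :=
  exists2 C : R, 0 < C & forall (r rho : R) (x : X),
    0 < r -> r < rho -> K x ->
    (cover_number r (cball x rho `&` K) <= (C * (rho / r) `^ s)%:E)%E.

Definition assouad_dim K : \bar R :=
  ereal_inf [set s%:E | s in [set s : R | 0 <= s /\ assouad_dim_bound K s]].

Definition lower_dim_bound K (s : R) : Prop :=
  exists2 C : R, 0 < C & forall (r rho : R) (x : X),
    0 < r -> r < rho -> (rho%:E <= maxe (diam K) 1)%E -> K x ->
    ((C * (rho / r) `^ s)%:E <= cover_number r (cball x rho `&` K))%E.

Definition lower_dim K : \bar R :=
  ereal_sup [set s%:E | s in [set s : R | 0 <= s /\ lower_dim_bound K s]].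

End dimensions.

Section properties.
Context {R : realType} (X : metricType R).

Definition doubling : Prop := (assouad_dim [set: X] < +oo)%E.

Definition uniformly_perfect : Prop := (0 < lower_dim [set: X])%E.

Definition assouad_sharp : Prop :=
  doubling /\ assouad_dim_bound [set: X] (fine (assouad_dim [set: X])).

End properties.

(* Main.v *)
(* Both players exploit the freedom of replacing a compact set by a nearby
   finite one.  Write q = alpha * beta, so that the radii of successive balls of
   the same player have ratio q.

   To make the lower dimension large, a player in a ball of radius r replaces
   each point of a fine net by M points which are 5 theta r separated and r / 4
   close to it, where theta r is the radius after the move (theta = alpha for
   Alice, theta = beta for Bob).  The outcome K is theta r close to this set, so
   K branches into M separated pieces when passing from scale r to q r, whence
   dim_L K >= s as soon as M >= (1 / q)^s.  If dim_L X > s' then M can be of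
   order theta^(-s').  For Alice M = 2 suffices to get dim_L K > 0; for Bob and
   s < s', taking beta small absorbs the factor alpha.

   To make the Assouad dimension small, a player replaces the set by an r / 2
   separated net.  The outcome K is then near boundedly many points in each ball
   of radius r, and its theta r neighbourhood of each of these is covered by
   C (theta / q)^s pieces of size q r.  Hence dim_A K <= t as soon as
   C^2 4^s (theta / q)^s <= q^(-t).  For Alice theta / q = 1 / beta, and when X is
   Assouad sharp, s = dim_A X > 0 is allowed: for alpha small with
   alpha^(-s) > C^2 4^s, depending only on X, this holds for some t < s whatever
   beta is.  For Bob theta / q = 1 / alpha does not depend on beta, and a small
   beta gives t = eps. *)

From mathcomp Require Import all_boot all_order all_algebra.
From mathcomp Require Import all_classical all_reals all_analysis.
From mathcomp Require Import finmap lra ring zify.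
Require Import Defs.

Set Implicit Arguments.
Unset Strict Implicit.
Unset Printing Implicit Defensive.

Import Order.TTheory GRing.Theory Num.Theory.
Import numFieldNormedType.Exports.

Local Open Scope classical_set_scope.
Local Open Scope ring_scope.

(** * Covering and packing numbers *)

Section covers_and_packings.
Context {R : realType} {X : metricType R}.
Implicit Types (A B : set X) (x y : X) (r s : R).

(** The counts whose infimum is [cover_number r A], kept in [nat] for the counting arguments. *)
Definition covered r A n := exists U : 'I_n -> set X,
  (forall i, open (U i) /\ (diam (U i) <= r%:E)%E) /\ A `<=` \bigcup_i U i.

(** The strict inequality ensures that a set of diameter at most [s] contains at most one of the
    points. *)
Definition packed s A n := exists f : 'I_n -> X,
  (forall i, A (f i)) /\ (forall i j, i != j -> s < mdist (f i) (f j)).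

Lemma diam_le A r : (forall x y, A x -> A y -> mdist x y <= r) <->
  (diam A <= r%:E)%E.
Proof.
split=> [Ar|dA x y Ax Ay].
  by apply: ge_ereal_sup => _ [[x y] [/= Ax Ay] <-]; rewrite lee_fin Ar.
rewrite -lee_fin (le_trans _ dA)//; apply: ereal_sup_ubound.
by exists (x, y).
Qed.

Lemma open_mball x r : open (ball x r).
Proof.
rewrite openE => y; rewrite ballEmdist /= => xy.
apply/nbhs_ballP; exists (r - mdist x y); first by rewrite /= subr_gt0.
move=> z; rewrite !ballEmdist /= ltrBrDl; exact/le_lt_trans/metric_triangle.
Qed.

Lemma covered_sub r r' A A' n n' : covered r A n -> r <= r' -> A' `<=` A ->
  (n <= n')%N -> covered r' A' n'.
Proof.
move=> [U [Ur AU]] rr' A'A nn'.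
(* Surplus indices get the empty set, whose diameter is -oo. *)
exists (fun i : 'I_n' => if insub (val i) is Some j then U j else set0); split.
  move=> i; case: insubP => [j _ _|_]; last first.
    by split; [exact: open0|apply/diam_le].
  by split; [exact: (Ur j).1|apply: le_trans (Ur j).2 _; rewrite lee_fin].
move=> x /A'A /AU[i _ Uix]; exists (widen_ord nn' i) => //.
by case: insubP => [j _ /val_inj ->//|]; rewrite /= ltn_ord.
Qed.

Lemma covered_fin (I : finType) (U : I -> set X) r A :
  (forall i, open (U i) /\ (diam (U i) <= r%:E)%E) -> A `<=` \bigcup_i U i ->
  covered r A #|I|.
Proof.
move=> Ur AU; exists (fun i => U (enum_val i)); split=> [i|x /AU[i _ Uix]].
  exact: Ur.
by exists (enum_rank i) => //; rewrite enum_rankK.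
Qed.

Lemma covered_bigcup m n (B : 'I_m -> set X) r A :
  (forall i, covered r (B i) n) -> A `<=` \bigcup_i B i -> covered r A (m * n).
Proof.
move=> /choice[U Uc] AB.
have := @covered_fin ('I_m * 'I_n)%type (fun ij => U ij.1 ij.2) r A.
rewrite card_prod !card_ord; apply.
  by move=> [i j]; exact: (Uc i).1.
move=> x /AB[i _ Bx]; have [j _ Ux] := (Uc i).2 _ Bx; by exists (i, j).
Qed.

Lemma covered_cball x s r : 0 < s -> 4 * s <= r -> covered r (cball x s) 1.
Proof.
move=> s0 sr; exists (fun=> ball x (s + s)); split=> [_|y /= xy]; last first.
  by exists ord0 => //; rewrite ballEmdist /= (le_lt_trans xy)// ltrDl.
split; first exact: open_mball.
apply/diam_le => y z; rewrite ballEmdist /= => xy xz.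
rewrite (le_trans (metric_triangle y x z))// (metric_sym y x); lra.
Qed.

Lemma cover_number_le r A n : covered r A n -> (cover_number r A <= n%:R%:E)%E.
Proof. by move=> An; apply: ereal_inf_lbound; exists n. Qed.

Lemma cover_number_ge r A c : (forall n, covered r A n -> c <= n%:R) ->
  (c%:E <= cover_number r A)%E.
Proof.
by move=> Ac; apply: le_ereal_inf_tmp => _ [n An <-]; rewrite lee_fin Ac.
Qed.

(** An infimum of natural numbers is attained, unless there is no finite cover, and then it is
    +oo. *)
Lemma cover_number_leP r A c : (cover_number r A <= c%:E)%E ->
  exists n, covered r A n /\ n%:R <= c.
Proof.
move=> Ac; have [[n An]|nA] := pselect (exists n, covered r A n); last first.
  suff : (+oo <= c%:E :> \bar R)%E by rewrite leye_eq.
  apply: le_trans Ac; apply: le_ereal_inf_tmp => y [n An _].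
  by case: nA; exists n.
have exn : exists n, `[< covered r A n >] by exists n; apply/asboolP.
case: (ex_minnP exn) => m /asboolP Am mmin; exists m; split => //.
rewrite -lee_fin (le_trans _ Ac)//; apply: cover_number_ge => k Ak.
by rewrite ler_nat; apply/mmin/asboolP.
Qed.

Lemma packed_sub s s' A A' n n' : packed s A n -> s' <= s -> A `<=` A' ->
  (n' <= n)%N -> packed s' A' n'.
Proof.
move=> [f [fA fs]] s's AA' n'n; exists (f \o widen_ord n'n); split=> [i|i j ij].
  exact/AA'/fA.
by apply: le_lt_trans s's _; apply: fs; apply: contra ij => /eqP[/val_inj ->].
Qed.

Lemma packed_fin (I : finType) (f : I -> X) s A : (forall i, A (f i)) ->
  (forall i j, i != j -> s < mdist (f i) (f j)) -> packed s A #|I|.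
Proof.
move=> fA fs; exists (f \o enum_val); split=> [i|i j ij]; first exact: fA.
by apply: fs; apply: contra ij => /eqP/enum_val_inj ->.
Qed.

(** Pigeonhole: one set of the cover cannot contain two points of the packing. *)
Lemma packed_covered s r A m n : r <= s -> packed s A m -> covered r A n ->
  (m <= n)%N.
Proof.
move=> rs [f [fA fs]] [U [Ur AU]].
have /choice[g gU] : forall i, exists j, U j (f i).
  by move=> i; have [j _] := AU _ (fA i); exists j.
have ginj : injective g.
  move=> i j gij; apply/eqP; apply: contraT => /fs.
  rewrite ltNge => /negP[]; apply: le_trans rs; move/diam_le : (Ur (g i)).2.
  by apply; rewrite // gij.
by have := leq_card g ginj; rewrite !card_ord.
Qed.

(** A packing that cannot be enlarged is a net: a point farther than [s] from all its members could
    be added. *)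
Lemma packed_maximal s A N : 0 <= s -> ~ packed s A N -> exists2 n, (n < N)%N &
  exists f : 'I_n -> X, [/\ forall i, A (f i),
    forall i j, i != j -> s < mdist (f i) (f j) &
    A `<=` \bigcup_i cball (f i) s].
Proof.
move=> s0; elim: N => [|N IHN] nA.
  have f : 'I_0 -> X by case.
  by case: nA; exists f; split=> -[].
have [[f [fA fs]]|/IHN[n nN nP]] := pselect (packed s A N); last first.
  by exists n => //; exact: ltnW.
exists N => //; exists f; split=> // x Ax; apply: contrapT => fx; apply: nA.
have xf i : s < mdist x (f i).
  rewrite ltNge; apply/negP => xfi; apply: fx; exists i => //=.
  by rewrite /cball /= metric_sym.
have := @packed_fin (option 'I_N) (fun o => if o is Some i then f i else x) s A.
rewrite card_option card_ord; apply => [[i|]//|[i|] [j|] ij] //.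
- exact: fs.
- by rewrite /= metric_sym.
Qed.

End covers_and_packings.

(** * Rounding radii to a geometric grid *)

Section geometric_scales.
Context {R : realType}.
Implicit Types q r rho s t : R.

Lemma exists_expr_lt q t : 0 < q < 1 -> 0 < t -> exists n, q ^+ n < t.
Proof.
move=> /andP[q0 q1] t0.
have q1' : `|q| < 1 by rewrite gtr0_norm.
have /cvgrPdist_lt/(_ t t0)[n _ nt] := cvg_expr q1'.
exists n; have := nt n (leqnn n).
by rewrite /= sub0r normrN gtr0_norm// exprn_gt0.
Qed.

Lemma geometric_scale q t (rho0 : R) : 0 < q < 1 -> 0 < rho0 -> 0 < t <= rho0 ->
  exists j, q ^+ j.+1 * rho0 < t <= q ^+ j * rho0.
Proof.
move=> q01 rho00 /andP[t0 t1].
have [n qn] := exists_expr_lt q01 (divr_gt0 t0 rho00).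
have ex : exists n, q ^+ n * rho0 < t by exists n; rewrite -ltr_pdivlMr.
case: (ex_minnP ex) => -[|j] jt jmin.
  by move: jt; rewrite expr0 mul1r ltNge t1.
by exists j; rewrite jt leNgt; apply/negP => /jmin; rewrite ltnn.
Qed.

(** For lower bounds: rounding [rho] down and [r] up loses at most a factor [q] at each end. The
    alternative [k = 0] is for [r] and [rho] too close together. *)
Lemma geometric_scales_inner q r rho (rho0 : R) :
  0 < q < 1 -> 0 < rho0 -> 0 < r -> 0 < rho <= rho0 ->
  exists n k, [/\ q ^+ n * rho0 <= rho, r <= q ^+ (n + k) * rho0 \/ k = 0%N &
    q ^+ 2 * rho * q ^+ k <= r].
Proof.
move=> q01 rho00 r0 rhoP; have /andP[q0 q1] := q01.
have [j /andP[jrho rhoj]] := geometric_scale q01 rho00 rhoP.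
have [rj|jr] := leP r (q ^+ j.+1 * rho0); last first.
  exists j.+1, 0%N; split; [exact: ltW|by right|].
  rewrite expr0 mulr1 (le_trans _ (ltW jr))// (exprS q j) expr2 -!mulrA.
  rewrite ler_pM2l// (le_trans _ rhoj)// ler_piMl// ltW//.
  by case/andP: rhoP.
have rP : 0 < r <= rho0.
  by rewrite r0 (le_trans rj)// ler_piMl ?exprn_ile1 ?ltW.
have [i /andP[ir ri]] := geometric_scale q01 rho00 rP.
have ji : (j < i)%N.
  have := lt_le_trans ir rj; rewrite ltr_pM2r// ltr_iXn2l//.
exists j.+1, (i - j.+1)%N; split; [exact: ltW|by left; rewrite subnKC|].
apply: le_trans (ltW ir).
have -> : q ^+ i.+1 = q ^+ 2 * q ^+ (i - j.+1) * q ^+ j.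
  by rewrite -!exprD; congr (_ ^+ _); lia.
rewrite mulrAC -[leRHS]mulrA ler_pM2l//.
by rewrite mulr_gt0// exprn_gt0.
Qed.

(** For upper bounds: the grid scales enclose [r] and [rho] at the cost of a factor [q] at each end.
    The last clause serves radii cut down to [rho0], where a cover by balls of radius exactly [rho0]
    is available. *)
Lemma geometric_scales_outer q r rho (rho0 : R) :
  0 < q < 1 -> 0 < rho0 -> 0 < r <= rho -> rho <= rho0 ->
  exists n k, [/\ rho <= q ^+ n * rho0, q ^+ (n + k.+1) * rho0 <= r,
    q ^+ 2 * r <= rho * q ^+ k.+1 & rho = rho0 -> n = 0%N].
Proof.
move=> q01 rho00 /andP[r0 rrho] rho1; have /andP[q0 q1] := q01.
have rhoP : 0 < rho <= rho0 by rewrite (lt_le_trans r0).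
have rP : 0 < r <= rho0 by rewrite r0 (le_trans rrho).
have [j /andP[jrho rhoj]] := geometric_scale q01 rho00 rhoP.
have [i /andP[ir ri]] := geometric_scale q01 rho00 rP.
have ji : (j <= i)%N.
  have := lt_le_trans ir (le_trans rrho rhoj).
  by rewrite ltr_pM2r// ltr_iXn2l.
exists j, (i - j)%N; rewrite -subSn//; split => //.
- by rewrite subnKC ?ltW// leqW.
- apply: le_trans (_ : q ^+ 2 * (q ^+ i * rho0) <= _).
    by rewrite ler_pM2l// exprn_gt0.
  have -> : q ^+ 2 * (q ^+ i * rho0) = q ^+ j.+1 * rho0 * q ^+ (i.+1 - j).
    by rewrite mulrA -exprD [RHS]mulrAC -exprD; congr (_ ^+ _ * _); lia.
  by rewrite ler_wpM2r ?exprn_ge0 ?ltW.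
- move=> rhoE; move: rhoj; rewrite rhoE; case: j {jrho ji} => // j.
  rewrite leNgt => /negP[]; rewrite gtr_pMl// exprn_ilt1 ?ltW//.
Qed.

Lemma powR_exprn q s k : 0 <= q -> (q ^+ k) `^ s = (q `^ s) ^+ k.
Proof. by move=> q0; rewrite -!powR_mulrn ?powR_ge0// powRAC. Qed.

End geometric_scales.

(** * Dimensions from self-similar coverings and packings *)

Section dimension_criteria.
Context {R : realType} {X : metricType R}.
Variables (K : set X) (q rho0 s : R) (M : nat).
Hypotheses (q01 : 0 < q < 1) (rho00 : 0 < rho0) (s0 : 0 <= s).

Let q0 : 0 < q. Proof. by case/andP: q01. Qed.
Let q1 : q < 1. Proof. by case/andP: q01. Qed.
Let scale0 n : 0 < q ^+ n * rho0. Proof. by rewrite mulr_gt0// exprn_gt0. Qed.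

(* The descendants of distinct children stay apart: each of them is within
   q^(n+1) rho0 of its parent, and the parents are 3 q^(n+1) rho0 apart. *)
Lemma packed_iter :
  (forall n x, K x -> exists f : 'I_M -> X,
    (forall i, K (f i) /\ mdist x (f i) <= (1 - q) * (q ^+ n * rho0)) /\
    (forall i j, i != j -> 3 * q * (q ^+ n * rho0) < mdist (f i) (f j))) ->
  forall k n x, K x ->
    packed (q ^+ (n + k) * rho0) (cball x (q ^+ n * rho0) `&` K) (M ^ k).
Proof.
move=> branch; elim=> [|k IHk] n x Kx.
  exists (fun=> x); split=> [_|i j]; last by rewrite !ord1 eqxx.
  by split => //; rewrite /cball /= mdistxx ltW.
have [f [fK fs]] := branch n x Kx.
have /choice[g gP] i := IHk n.+1 (f i) (fK i).1.
have sE : q ^+ n.+1 * rho0 = q * (q ^+ n * rho0) by rewrite exprS mulrA.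
have := @packed_fin _ _ ('I_M * 'I_(M ^ k))%type (fun ij => g ij.1 ij.2)
  (q ^+ (n + k.+1) * rho0) (cball x (q ^+ n * rho0) `&` K).
rewrite card_prod !card_ord -expnS; apply => [[i j]|[i j] [i' j'] ij] /=.
  have [[fg Kg] _] := ((gP i).1 j, tt); split => //.
  have := metric_triangle x (f i) (g i j); have := (fK i).2.
  move: fg; rewrite /cball /= sE; lra.
have [ii'|ii'] := eqVneq i i'.
  rewrite addnS -addSn -ii'; apply: (gP i).2.
  by apply: contra ij => /eqP jj'; rewrite ii' jj'.
have [+ _] := (gP i).1 j; have [+ _] := (gP i').1 j'.
have := fs _ _ ii'; have := metric_triangle (f i) (g i j) (f i').
have := metric_triangle (g i j) (g i' j') (f i').
rewrite /cball /= sE (metric_sym (g i' j')).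
suff : q ^+ (n + k.+1) * rho0 <= q * (q ^+ n * rho0) by lra.
by rewrite -sE ler_pM2r// ler_iXn2l// addnS ltnS leq_addr.
Qed.

(** After [k] generations there are M^k >= q^(-ks) separated points, and q^(-k) is comparable to rho
    / r. *)
Lemma lower_dim_bound_of_branching D :
  (diam K <= D%:E)%E -> (q^-1) `^ s <= M%:R ->
  (forall n x, K x -> exists f : 'I_M -> X,
    (forall i, K (f i) /\ mdist x (f i) <= (1 - q) * (q ^+ n * rho0)) /\
    (forall i j, i != j -> 3 * q * (q ^+ n * rho0) < mdist (f i) (f j))) ->
  lower_dim_bound K s.
Proof.
move=> KD qM branch.
(* Admissible [rho] may exceed [rho0] but not [D'], so cutting them down to [rho0] shrinks them at
   worst by the factor [c]. *)
pose D' := Num.max D 1; pose c := rho0 / (D' + rho0).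
have D'0 : 0 < D' by rewrite lt_max ltr01 orbT.
have c0 : 0 < c by rewrite divr_gt0// addr_gt0.
have qc0 : 0 < q ^+ 2 * c by rewrite mulr_gt0// exprn_gt0.
exists ((q ^+ 2 * c) `^ s); first exact: powR_gt0.
move=> r rho x r0 rrho rhoD Kx; have rho_gt0 := lt_trans r0 rrho.
have {}rhoD : rho <= D'.
  rewrite -lee_fin (le_trans rhoD)// EFin_max ge_max !le_max KD/=.
  by rewrite lexx orbT.
pose rho' := Num.min rho rho0.
have rho'P : 0 < rho' <= rho0 by rewrite lt_min rho_gt0 rho00 ge_min lexx orbT.
have crho : c * rho <= rho'.
  have Dr : 0 < D' + rho0 by rewrite addr_gt0.
  rewrite /rho' /c mulrAC le_min !ler_pdivrMr//.
  by apply/andP; split; nra.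
have [n [k [nrho rk qk]]] := geometric_scales_inner q01 rho00 r0 rho'P.
have pk : packed r (cball x rho `&` K) (M ^ k).
  have nball : cball x (q ^+ n * rho0) `&` K `<=` cball x rho `&` K.
    move=> y [xy Ky]; split => //; apply: le_trans xy _.
    by rewrite (le_trans nrho)// ge_min lexx.
  case: rk => [rk|->].
    exact: packed_sub (packed_iter branch k n Kx) rk nball _.
  exists (fun=> x); split=> [_|i j]; last by rewrite !ord1 eqxx.
  by split => //; rewrite /cball /= mdistxx ltW.
apply: cover_number_ge => N /(packed_covered (lexx r) pk) MN.
apply: le_trans (_ : (M ^ k)%:R <= _); last by rewrite ler_nat.
rewrite -powRM ?(ltW qc0)//; last by rewrite ltW// divr_gt0.
apply: le_trans (_ : ((q^-1) `^ s) ^+ k <= _); last first.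
  by rewrite natrX lerXn2r// nnegrE ?powR_ge0.
rewrite -powR_exprn ?invr_ge0 ?(ltW q0)//; apply: ge0_ler_powR => //.
- by rewrite nnegrE ltW// mulr_gt0// divr_gt0.
- by rewrite nnegrE exprn_ge0// invr_ge0 ltW.
rewrite exprVn -[leRHS]mul1r ler_pdivlMr ?exprn_gt0//.
rewrite mulrA mulrAC ler_pdivrMr// mul1r (le_trans _ qk)//.
by rewrite ler_pM2r ?exprn_gt0// -mulrA ler_pM2l// exprn_gt0.
Qed.

(** A set of the cover that meets [K] lies in a ball of the next scale around one of its points of
    [K], where the induction hypothesis applies; the other sets contribute nothing. *)
Lemma covered_iter :
  (forall n x, K x -> covered (q ^+ n.+1 * rho0) (cball x (q ^+ n * rho0) `&` K) M) ->
  forall k n x, K x ->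
    covered (q ^+ (n + k.+1) * rho0) (cball x (q ^+ n * rho0) `&` K) (M ^ k.+1).
Proof.
move=> cover; elim=> [|k IHk] n x Kx; first by rewrite addn1 expn1; exact: cover.
have [U [Uc KU]] := cover n x Kx.
rewrite expnS; apply: covered_bigcup (fun i => U i `&` K) _ _ _ _.
  move=> i; have [[z [Uz Kz]]|UK] := pselect ((U i `&` K) !=set0).
    rewrite addnS -addSn; apply: covered_sub (IHk n.+1 z Kz) _ _ _ => // y [Uy Ky].
    by split => //; move/diam_le : (Uc i).2; exact.
  exists (fun=> set0); split=> [_|y UKy]; last by case: UK; exists y.
  by split; [exact: open0|apply/diam_le].
by move=> y [xy Ky]; have [i _ Uy] := KU y (conj xy Ky); exists i.
Qed.

Lemma assouad_dim_bound_of_covering P (z : 'I_P -> X) :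
  (forall i, K (z i)) -> K `<=` \bigcup_i cball (z i) rho0 ->
  M%:R <= (q^-1) `^ s ->
  (forall n x, K x -> covered (q ^+ n.+1 * rho0) (cball x (q ^+ n * rho0) `&` K) M) ->
  assouad_dim_bound K s.
Proof.
move=> zK Kz Mq cover.
have qV0 : 0 < (q ^+ 2)^-1 by rewrite invr_gt0 exprn_gt0.
(* [P.+1] bounds both the single ball needed for [rho <= rho0] and the [P] balls needed beyond;
   q^(-2) pays for rounding to the grid. *)
exists (P.+1%:R * ((q ^+ 2)^-1) `^ s); first by rewrite mulr_gt0// powR_gt0.
move=> r rho x r0 rrho Kx; have rho_gt0 := lt_trans r0 rrho.
(* Cutting both radii down to [rho0] does not increase their ratio. *)
pose rho' := Num.min rho rho0; pose r' := Num.min r rho0.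
have r'P : 0 < r' <= rho' by rewrite lt_min r0 rho00/= le_min !ge_min lexx ltW// orbT.
have rho'0 : rho' <= rho0 by rewrite ge_min lexx orbT.
have [n [k [rhon nr qk n0]]] := geometric_scales_outer q01 rho00 r'P rho'0.
have r'0 : 0 < r' by case/andP: r'P.
have rr' : rho' / r' <= rho / r.
  rewrite ler_pdivrMr// mulrAC ler_pdivlMr// /rho' /r'.
  by case: (leP rho rho0); case: (leP r rho0) => *; nra.
have iter w : K w ->
    covered r (cball w (q ^+ n * rho0) `&` K) (M ^ k.+1).
  move=> Kw; apply: covered_sub (covered_iter cover k n Kw) _ _ _ => //.
  by rewrite (le_trans nr)// ge_min lexx.
have Pcov : covered r (cball x rho `&` K) (P.+1 * M ^ k.+1).
  have [rho_le|rho_gt] := leP rho rho0.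
    apply: covered_sub (iter x Kx) _ _ _ => //; last by rewrite leq_pmull.
    move=> y [xy Ky]; split => //; apply: le_trans xy _.
    by apply: le_trans rhon; rewrite le_min lexx.
  apply: covered_sub (_ : covered r K (P * M ^ k.+1)) _ _ _ => //.
    apply: covered_bigcup (fun i => cball (z i) rho0 `&` K) _ _ _ _ => [i|y Ky].
      apply: covered_sub (iter _ (zK i)) _ _ _ => // y [zy Ky]; split=> //.
      by rewrite n0 ?expr0 ?mul1r// /rho' min_r// ltW.
    by have [i _ yz] := Kz y Ky; exists i.
  by rewrite leq_mul2r leqnSn orbT.
apply: le_trans (cover_number_le Pcov) _; rewrite lee_fin natrM -mulrA.
rewrite ler_pM2l// -powRM ?(ltW qV0)//; last by rewrite ltW// divr_gt0.
apply: le_trans (_ : ((q^-1) `^ s) ^+ k.+1 <= _).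
  by rewrite natrX lerXn2r// nnegrE ?powR_ge0.
rewrite -powR_exprn ?invr_ge0 ?(ltW q0)//; apply: ge0_ler_powR => //.
- by rewrite nnegrE exprn_ge0// invr_ge0 ltW.
- by rewrite nnegrE ltW// mulr_gt0// divr_gt0.
apply: le_trans (_ : (q ^+ 2)^-1 * (rho' / r') <= _); last by rewrite ler_pM2l.
rewrite exprVn mulrA ler_pdivlMr// mulrC ler_pdivrMr ?exprn_gt0//.
by rewrite -mulrA ler_pdivlMl// exprn_gt0.
Qed.

End dimension_criteria.

(** * The Hausdorff metric *)

Section hausdorff_metric.
Context {R : realType} {X : metricType R}.
Implicit Types A B : compacts X.

Lemma continuous_mdist (x : X) : continuous (mdist x : X -> R^o).
Proof.
move=> y; apply/(@cvgrPdist_lt R R^o) => e e0.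
near=> z; have : ball y e z by near: z; exact: nbhsx_ballx.
rewrite ballEmdist /= => yz; rewrite distrC; apply: le_lt_trans yz.
have := metric_triangle x y z; have := metric_triangle x z y.
by rewrite (metric_sym z y) ler_norml => *; apply/andP; split; lra.
Unshelve. all: by end_near. Qed.

(** The distance to [x] attains its minimum on the compact set [B]. *)
Lemma compacts_near B (x : X) e :
  (forall e', e < e' -> exists2 b, cset B b & mdist x b <= e') ->
  exists2 b, cset B b & mdist x b <= e.
Proof.
move=> xB.
have [|c /set_mem Bc cmin] := compact_EVT_min (cset_nonempty B) (@cset_compact _ _ B)
  (f := mdist x : X -> R).
  exact/continuous_subspaceT/continuous_mdist.
exists c => //; apply/ler_addgt0Pl => d d0.
have [|b Bb xb] := xB (d + e); first by rewrite ltrDr.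
by apply: le_trans xb; apply/cmin/mem_set.
Qed.

Lemma compacts_bounded A (x : X) : exists M, A `<=` cball x M.
Proof.
have [|c _ cmax] := compact_EVT_max (cset_nonempty A) (@cset_compact _ _ A)
  (f := mdist x : X -> R).
  exact/continuous_subspaceT/continuous_mdist.
by exists (mdist x c) => a Aa; apply/cmax/mem_set.
Qed.

Lemma hausdorff_radii_nonempty A B : hausdorff_radii A B !=set0.
Proof.
have [[a Aa] [b Bb]] := (cset_nonempty A, cset_nonempty B).
have [M AM] := compacts_bounded A b; have [N BN] := compacts_bounded B a.
have [M0 N0] : 0 <= M /\ 0 <= N.
  by split; [apply: le_trans (AM a Aa)|apply: le_trans (BN b Bb)]; exact: mdist_ge0.
exists (M + N); split; first exact: addr_ge0.
- by move=> x /AM; rewrite /cball /= metric_sym => bx; exists b => //; lra.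
- by move=> x /BN; rewrite /cball /= metric_sym => ax; exists a => //; lra.
Qed.

(** By compactness the infimum defining the Hausdorff distance is attained, so the inclusions hold
    at [e] itself and not only at larger radii. *)
Lemma mdist_compacts_leP A B e : 0 <= e ->
  mdist A B <= e <-> A `<=` cthickening e B /\ B `<=` cthickening e A.
Proof.
have lb : has_lbound (hausdorff_radii A B) by exists 0 => d [].
move=> e0; split=> [ABe|[AB BA]]; last exact: ge_inf.
have radius e' : e < e' -> exists2 d, hausdorff_radii A B d & d <= e'.
  rewrite -subr_gt0 => ee'.
  have [d dAB dlt] := inf_adherent ee' (conj (hausdorff_radii_nonempty A B) lb).
  exists d => //; rewrite (le_trans (ltW dlt))//.
  by move: ABe; rewrite mdist_compactsE /hausdorff_dist; lra.
split=> x Ax; apply: compacts_near => e' /radius[d [_ AB BA] de'].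
  by have [b Bb xb] := AB x Ax; exists b => //; apply: le_trans de'.
by have [b Bb xb] := BA x Ax; exists b => //; apply: le_trans de'.
Qed.

Definition finite_compacts (I : finType) (i0 : I) (f : I -> X) : compacts X :=
  @Compacts _ _ (range f) (finite_compact (finite_image f (@finite_finset _ setT)))
  (ex_intro _ (f i0) (ex_intro2 _ _ i0 Logic.I erefl)).

End hausdorff_metric.

(** * Finite covers and nets of compact sets *)

Section compact_covers.
Context {R : realType} {X : completeMetricType R}.

Lemma compact_covered (A : set X) r : 0 < r -> compact A -> exists n, covered r A n.
Proof.
move=> r0; rewrite compact_cover => cA.
have [|x _|D _ AD] := cA X [set: X] (fun x => ball x (r / 2)).
- by move=> x _; exact: open_mball.
- by exists x => //; apply: ballxx; rewrite divr_gt0.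
eexists; apply: (@covered_fin _ _ (fset_sub_type D) (fun x => ball (val x) (r / 2))).
  move=> i; split; first exact: open_mball.
  apply/diam_le => y z; rewrite !ballEmdist /= => iy iz.
  rewrite (le_trans (metric_triangle y (val i) z))// (metric_sym y); lra.
by move=> x /AD[y Dy xy]; exists (FSetSub Dy).
Qed.

(** A finite cover bounds the size of [s]-separated families, so there is a maximal one; it is a
    net, and not empty since [A] is not. *)
Lemma compact_net (A : compacts X) s : 0 < s -> exists n, exists f : 'I_n.+1 -> X,
  [/\ forall i, cset A (f i), forall i j, i != j -> s < mdist (f i) (f j) &
    A `<=` \bigcup_i cball (f i) s].
Proof.
move=> s0; have [N AN] := compact_covered s0 (@cset_compact _ _ A).
have [|[|n] _ [f [fA fs Af]]] := @packed_maximal _ _ s A N.+1 (ltW s0).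
- by move=> pA; have := packed_covered (lexx s) pA AN; rewrite ltnn.
- by have [x /Af[[]]] := cset_nonempty A.
- by exists n, f.
Qed.

End compact_covers.

(** * Completeness of the hyperspace, and strategies *)

Section nested_balls.
Context {R : realType} {X : completeMetricType R}.
Variables (A : nat -> compacts X) (r : nat -> R).
Hypotheses (r_ge0 : forall n, 0 <= r n)
  (r_small : forall e, 0 < e -> exists n, r n < e)
  (nested : forall n, mdist (A n) (A n.+1) + r n.+1 <= r n).

Let T n := cthickening (r n) (A n).

Let AS n : A n `<=` cthickening (r n - r n.+1) (A n.+1) /\
  A n.+1 `<=` cthickening (r n - r n.+1) (A n).
Proof.
have mAS : mdist (A n) (A n.+1) <= r n - r n.+1 by have := nested n; lra.
by apply/mdist_compacts_leP => //; apply: le_trans mAS; exact: mdist_ge0.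
Qed.

Let T_decr n m : T (n + m) `<=` T n.
Proof.
elim: m => [|m IHm]; first by rewrite addn0.
rewrite addnS => x [a /(AS _).2[b Ab ab] xa]; apply: IHm; exists b => //.
by have := metric_triangle x a b; lra.
Qed.

(* The sets T n are totally bounded up to r n, so an ultrafilter containing them
   all is Cauchy. *)
Let ultra_cvg (F : set_system X) : UltraFilter F -> (forall n, F (T n)) ->
  exists p, F --> p /\ forall n, T n p.
Proof.
move=> FU FT; have FF := @ultra_proper _ F FU.
have /cauchy_cvgP/cvg_ex[p Fp] : cauchy F.
  apply: cauchy_exP => e e0; have e4 : 0 < e / 4 by rewrite divr_gt0.
  have [n rn] := r_small e4.
  have [N [f [_ _ Af]]] := compact_net (A n) e4.
  apply: contrapT => /forallNP noball.
  have nF i : F (~` ball (f i) e).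
    by have [|//] := in_ultra_setVsetC (ball (f i) e) FU => /noball.
  have Fout : F (fun x => forall i, (~` ball (f i) e) x) by exact: filter_forall.
  have [x [[a /Af[i _ ia] xa] xf]] := filter_ex (filterI (FT n) Fout).
  apply: (xf i); rewrite ballEmdist /=.
  have := metric_triangle (f i) a x; rewrite (metric_sym a).
  by move: ia; rewrite /cball /=; lra.
exists p; split=> // n; apply: compacts_near => e' e'r.
have Fb : F (ball p (e' - r n)) by apply: Fp; apply: nbhsx_ballx; rewrite subr_gt0.
have [x [[a Aa xa]]] := filter_ex (filterI (FT n) Fb).
rewrite ballEmdist /= => px; exists a => //.
by have := metric_triangle p x a; lra.
Qed.

(** A set within [r n] of every [A n] is contained in all [T n], so this is the largest candidate
    for the outcome. *)
Let limit := [set p | forall n, T n p].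

Let compact_limit : compact limit.
Proof.
rewrite compact_ultra => F FU FP.
have [|p [Fp pT]] := @ultra_cvg F FU; last by exists p.
by move=> n; apply: filterS FP => p; exact.
Qed.

(** A chain of nearby points through the later sets stays within [r n] of [a], because the radii
    telescope. Hence the sets generating [G] are nonempty, and an ultrafilter finer than [G]
    converges to the wanted point. *)
Let limit_near n a : cset (A n) a -> exists2 p, limit p & mdist a p <= r n.
Proof.
move=> Aa.
have chain m : exists2 b, cset (A (n + m)) b & mdist a b <= r n - r (n + m).
  elim: m => [|m [b Ab ab]]; first by exists a; rewrite addn0// mdistxx subrr.
  have [c Ac bc] := (AS (n + m)).1 _ Ab; exists c; rewrite addnS//.
  by have := metric_triangle a b c; lra.
pose G := filter_from [set: nat] (fun m => T (n + m) `&` cball a (r n)).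
have GF : ProperFilter G.
  apply: filter_from_proper => [|m _].
    apply: filter_from_filter => [|i j _ _]; first by exists 0%N.
    exists (i + j)%N => // x [xT xa]; split; split => //.
      by apply: T_decr; rewrite -addnA; exact: xT.
    by apply: T_decr; rewrite -addnA (addnC j); exact: xT.
  have [b Ab ab] := chain m; exists b; split; first by exists b => //; rewrite mdistxx.
  by rewrite /cball /= (le_trans ab)// gerBl.
have [F [FU GF']] := ultraFilterLemma GF.
have [|p [Fp pT]] := @ultra_cvg F FU.
  move=> m; apply: GF'; exists m => // x [xT _].
  by rewrite addnC in xT; exact: T_decr xT.
have Fa : F (cball a (r n)) by apply: GF'; exists 0%N => // x [].
exists p => //; apply/ler_addgt0Pl => e e0.
have FF := @ultra_proper _ F FU.
have [x []] := filter_ex (filterI Fa (Fp _ (nbhsx_ballx p e e0))).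
rewrite ballEmdist /cball /= => ax px.
by have := metric_triangle a x p; rewrite (metric_sym x); lra.
Qed.

(** Existence of the outcome of a play; completeness of the hyperspace enters the games in this
    form. *)
Lemma compacts_nested_balls : exists K : compacts X, forall n, mdist (A n) K <= r n.
Proof.
have limit0 : limit !=set0.
  by have [a /limit_near[p lp _]] := cset_nonempty (A 0); exists p.
exists (Compacts compact_limit limit0) => n; apply/mdist_compacts_leP => //.
by split=> [a /limit_near[p]|p]; [exists p|exact].
Qed.

End nested_balls.

Section game_responses.
Context {R : realType} {Y : metricType R}.

(* Positional strategies, in which f r x is the reply to the ball of center x and
   radius r.  In [not_winning_response] Bob starts with radius 1 around x0. *)
Lemma alpha_winning_response (alpha : R) (S : set Y) (y0 : Y) : 0 < alpha < 1 ->
  (forall (x : nat -> Y) (r : nat -> R), (forall n, 0 <= r n) ->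
    (forall e, 0 < e -> exists n, r n < e) ->
    (forall n, mdist (x n) (x n.+1) + r n.+1 <= r n) ->
    exists p, forall n, mdist (x n) p <= r n) ->
  (forall beta, 0 < beta < 1 -> exists f : R -> Y -> Y,
    (forall r x, 0 < r -> mdist x (f r x) + alpha * r <= r) /\
    forall r0 p, 0 < r0 -> (forall n, exists x,
      mdist (f ((alpha * beta) ^+ n * r0) x) p <= alpha * ((alpha * beta) ^+ n * r0)) ->
      S p) ->
  alpha_winning alpha S.
Proof.
move=> alpha01 balls resp beta beta01; have [f [flegal fS]] := resp beta beta01.
have /andP[a0 a1] := alpha01; have /andP[b0 b1] := beta01.
have q0 : 0 < alpha * beta by rewrite mulr_gt0.
have q1 : alpha * beta < 1 by rewrite mulr_ilt1// ltW.
(* When Alice sees x_0, ..., x_n the list has length n + 1, whence the predecessor in the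
   exponent. *)
exists (fun r0 s => f ((alpha * beta) ^+ (size s).-1 * r0) (last y0 s)).
move=> r0 x r y r00 bob.
have rn0 n : 0 < r n by rewrite mulr_gt0// exprn_gt0.
have yE n : y n.+1 = f (r n) (x n).
  by rewrite /y size_mkseq mkseqS last_rcons.
have alice n : mdist (x n) (y n.+1) + alpha * r n <= r n by rewrite yE flegal.
have rS n : r n.+1 = alpha * beta * r n by rewrite /r exprS mulrA.
have r_small e : 0 < e -> exists n, r n < e.
  have q01 : 0 < alpha * beta < 1 by rewrite q0.
  move=> e0; have [n ne] := exists_expr_lt q01 (divr_gt0 e0 r00).
  by exists n; rewrite -ltr_pdivlMr.
have [|||p px] := balls x r.
- by move=> n; exact: ltW.
- exact: r_small.
- move=> n; have := metric_triangle (x n) (y n.+1) (x n.+1).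
  have := bob n; have := alice n; rewrite rS; lra.
(* Bob's rule puts his next ball, which contains [p], inside Alice's ball. *)
have py n : mdist (y n.+1) p <= alpha * r n.
  have := metric_triangle (y n.+1) (x n.+1) p; have := bob n; have := px n.+1.
  by rewrite rS; lra.
split=> //; exists p.
  by apply: (fS r0) => // n; exists (x n); rewrite -/(r n) -yE.
apply/seteqP; split=> [z xz|_ -> n _]; last by split; [exact: px|exact: py].
(* Two points common to all balls around the [x n] are at distance at most [2 * r n]. *)
apply/esym/mdist_positivity/eqP; rewrite eq_le mdist_ge0 andbT.
apply/ler_addgt0Pl => e e0; have [n rn] := r_small _ (divr_gt0 e0 (ltr0Sn R 1)).
have [] := xz n I; rewrite /cball /= => xnz _.
have := px n; have := metric_triangle p (x n) z; rewrite (metric_sym p (x n)); lra.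
Qed.

Lemma not_winning_response (S : set Y) (x0 : Y) :
  (forall alpha, 0 < alpha < 1 -> exists2 beta, 0 < beta < 1 &
    exists f : R -> Y -> Y,
    (forall r y, 0 < r -> r <= 1 -> mdist y (f r y) + beta * r <= r) /\
    forall p, (forall n, exists y,
      mdist (f ((alpha * beta) ^+ n * alpha) y) p <= beta * ((alpha * beta) ^+ n * alpha)) ->
      ~ S p) ->
  ~ winning S.
Proof.
move=> resp [alpha alpha01]; have [beta beta01 [f [flegal fS]]] := resp alpha alpha01.
move=> /(_ beta beta01)[sigma].
have /andP[a0 a1] := alpha01; have /andP[b0 b1] := beta01.
have q0 : 0 < alpha * beta by rewrite mulr_gt0.
have q1 : alpha * beta < 1 by rewrite mulr_ilt1// ltW.
(* Alice's radius in round n + 1 when Bob opens with radius 1. *)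
pose r n := (alpha * beta) ^+ n * alpha.
have r0 n : 0 < r n by rewrite mulr_gt0// exprn_gt0.
have r1 n : r n <= 1.
  by rewrite mulr_ile1 ?exprn_ge0 ?exprn_ile1 ?(ltW a1) ?(ltW a0) ?(ltW q0) ?(ltW q1).
(* [H n] lists Bob's centers x_0, ..., x_n when [f] is played against [sigma]. *)
pose H := fix H n : seq Y := if n is m.+1 then rcons (H m) (f (r m) (sigma 1 (H m)))
  else [:: x0].
pose x n := last x0 (H n).
have xH n : mkseq x n.+1 = H n.
  by elim: n => //= n IHn; rewrite mkseqS IHn /x /= last_rcons.
have xS n : x n.+1 = f (r n) (sigma 1 (mkseq x n.+1)).
  by rewrite xH /x /= last_rcons.
have rE n : r n = alpha * ((alpha * beta) ^+ n * 1) by rewrite mulr1 mulrC.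
move=> /(_ 1 x ltr01)[n|_ [p Sp px]].
  rewrite xS -rE -mulrA (mulrCA alpha) -rE.
  by apply: flegal.
apply: fS Sp => n; exists (sigma 1 (mkseq x n.+1)); rewrite -/(r n) -xS.
have : (\bigcap_n (cball (x n) ((alpha * beta) ^+ n * 1) `&`
  cball (sigma 1 (mkseq x n.+1)) (alpha * ((alpha * beta) ^+ n * 1)))) p by rewrite px.
(* Bob's ball of index n + 1 has radius [beta * r n]. *)
move=> /(_ n.+1 I)[+ _]; rewrite /cball /= rE mulr1 exprS => /le_trans; apply.
by rewrite mulr1 mulrA (mulrC beta).
Qed.

End game_responses.

(** * The moves *)

Section powers.
Context {R : realType}.

Lemma powR_ln_div (Q L : R) : 1 < Q -> 0 < L -> Q `^ (ln L / ln Q) = L.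
Proof.
move=> Q1 L0; have Q0 : 0 < Q := lt_trans ltr01 Q1.
by rewrite /powR gt_eqF// divfK ?lnK ?posrE// gt_eqF// ln_gt0.
Qed.

Lemma exists_powR_ge (s L tau : R) : 0 < s -> 0 < tau ->
  exists2 t, 0 < t <= tau & L <= (t^-1) `^ s.
Proof.
(* Since u^s = max(L, 1), any positive t up to 1/u works. *)
move=> s0 tau0; pose u := (Num.max L 1) `^ s^-1; pose t := Num.min tau u^-1.
have L1 : 0 < Num.max L 1 by rewrite lt_max ltr01 orbT.
have u0 : 0 < u by exact: powR_gt0.
have t0 : 0 < t by rewrite lt_min tau0 invr_gt0.
exists t; first by rewrite t0 ge_min lexx.
apply: le_trans (_ : u `^ s <= _).
  by rewrite -powRrM mulVf ?gt_eqF// powRr1 ?(ltW L1)// le_max lexx.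
apply: ge0_ler_powR; rewrite ?nnegrE ?invr_ge0 ?(ltW s0) ?(ltW u0) ?(ltW t0)//.
by rewrite -[leLHS]invrK lef_pV2 ?posrE ?invr_gt0// ge_min lexx orbT.
Qed.

(** The logarithm of [L] to base [Q] lies below [s]; the maximum with 0 handles [L < 1]. *)
Lemma exists_powR_exponent (Q L s : R) : 1 < Q -> 0 < s -> 0 < L < Q `^ s ->
  exists2 t, 0 <= t < s & L <= Q `^ t.
Proof.
move=> Q1 s0 /andP[L0 LQ]; have Q0 : 0 < Q := lt_trans ltr01 Q1.
exists (Num.max 0 (ln L / ln Q)).
  rewrite le_max lexx/= gt_max s0 ltr_pdivrMr ?ln_gt0//.
  by rewrite -ln_powR ltr_ln ?posrE// powR_gt0.
rewrite -[leLHS](powR_ln_div Q1 L0); apply: ler_powR; first exact: ltW.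
by rewrite le_max lexx orbT.
Qed.

End powers.

Section responses.
Context {R : realType} {X : completeMetricType R}.
Implicit Types A B K : compacts X.

(** The bound [r / 2] arises because the points of one cluster are [r / 4] close to a common net
    point. *)
Definition branching M (r s : R) A := forall p, cset A p -> exists f : 'I_M -> X,
  (forall i, cset A (f i) /\ mdist p (f i) <= r / 2) /\
  (forall i j, i != j -> s < mdist (f i) (f j)).

Definition separated_finite (s : R) A := exists n (f : 'I_n.+1 -> X),
  A = finite_compacts ord0 f /\ forall i j, i != j -> s < mdist (f i) (f j).

(** Clusters of different net points may overlap, which is harmless: only the [M] points of one
    cluster must be separated. *)
Lemma exists_branching A M r s : 0 < r -> (0 < M)%N ->
  (forall x : X, packed s (cball x (r / 4)) M) ->
  exists B, mdist A B <= r / 2 /\ branching M r s B.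
Proof.
move=> r0; case: M => // M _ /choice[g gP].
have r4 : 0 < r / 4 by rewrite divr_gt0.
have [n [f [fA _ Af]]] := compact_net A r4.
have Bnear i j : mdist (f i) (g (f i) j) <= r / 4 by exact: (gP (f i)).1.
exists (finite_compacts (ord0, ord0)
  (fun ij : 'I_n.+1 * 'I_M.+1 => g (f ij.1) ij.2)); split.
  apply/mdist_compacts_leP; first by rewrite divr_ge0 ?ltW.
  split=> [x /Af[i _ ix]|_ [[i j] _ <-]] /=.
    exists (g (f i) ord0); first by exists (i, ord0).
    have := metric_triangle x (f i) (g (f i) ord0).
    by have := Bnear i ord0; move: ix; rewrite /cball /= (metric_sym x (f i)); lra.
  by exists (f i) => //; rewrite metric_sym (le_trans (Bnear i j))//; lra.
move=> _ [[i j] _ <-] /=; exists (g (f i)); split; last exact: (gP (f i)).2.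
move=> k; split; first by exists (i, k).
have := metric_triangle (g (f i) j) (f i) (g (f i) k).
have := Bnear i j; have := Bnear i k.
rewrite (metric_sym _ (f i)); lra.
Qed.

Lemma exists_separated_finite A r : 0 < r ->
  exists B, mdist A B <= r / 2 /\ separated_finite (r / 2) B.
Proof.
move=> r0; have r2 : 0 < r / 2 by rewrite divr_gt0.
have [n [f [fA fs Af]]] := compact_net A r2.
exists (finite_compacts ord0 f); split; last by exists n, f.
apply/mdist_compacts_leP; first exact: ltW.
split=> [x /Af[i _ ix]|_ [i _ <-]].
  by exists (f i); [exists i|rewrite metric_sym].
by exists (f i) => //; rewrite mdistxx ltW.
Qed.

Lemma exists_response (P : R -> compacts X -> Prop) :
  (forall r A, 0 < r -> exists B, mdist A B <= r / 2 /\ P r B) ->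
  exists f : R -> compacts X -> compacts X,
    forall r A, 0 < r -> mdist A (f r A) <= r / 2 /\ P r (f r A).
Proof.
move=> resp.
have /choice[f fP] : forall rA : R * compacts X, exists B,
    0 < rA.1 -> mdist rA.2 B <= rA.1 / 2 /\ P rA.1 B.
  move=> [r A]; have [/(resp r A)[B BP]|r0] := pselect (0 < r); first by exists B.
  by exists A.
by exists (fun r A => f (r, A)) => r A; exact: (fP (r, A)).
Qed.

(** Moving the branches from [A] to [K] costs [theta * r] at each end. Separation drops from 5 theta
    r to 3 theta r >= 3 q r, and the distance grows to r / 2 + 2 theta r <= (1 - q) r, by q <= theta
    <= 1/6. *)
Lemma lower_dim_bound_of_near_branching K (q theta rho0 s : R) M :
  0 < q -> q <= theta -> theta <= 6^-1 -> 0 < rho0 -> 0 <= s ->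
  (q^-1) `^ s <= M%:R ->
  (forall n, exists2 A, branching M (q ^+ n * rho0) (5 * theta * (q ^+ n * rho0)) A &
    mdist A K <= theta * (q ^+ n * rho0)) ->
  lower_dim_bound K s.
Proof.
move=> q0 qtheta theta6 rho00 s0 qM near.
have q01 : 0 < q < 1 by rewrite q0/=; lra.
have [x0 _] := cset_nonempty K; have [D KD] := compacts_bounded K x0.
apply: (lower_dim_bound_of_branching q01 rho00 s0 (D := D + D) (M := M)) => //.
  apply/diam_le => x y /KD + /KD; rewrite /cball /= => xD yD.
  by rewrite (le_trans (metric_triangle x x0 y))// metric_sym lerD// metric_sym.
move=> n x Kx; have [A Abr AK] := near n.
set r := q ^+ n * rho0 in Abr AK *.
have r0 : 0 < r by rewrite mulr_gt0// exprn_gt0.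
have thetar0 : 0 <= theta * r by rewrite mulr_ge0 ?(ltW r0)//; lra.
have [AKn KAn] := (mdist_compacts_leP A K thetar0).1 AK.
have [p Ap xp] := KAn x Kx; have [f [fA fs]] := Abr p Ap.
have /choice[g gP] i : exists y, cset K y /\ mdist (f i) y <= theta * r.
  by have [y Ky fy] := AKn _ (fA i).1; exists y.
have qr : q * r <= theta * r by rewrite ler_pM2r.
have tr : theta * r <= 6^-1 * r by rewrite ler_pM2r.
exists g; split=> [i|i j ij].
  split; first exact: (gP i).1.
  have := (gP i).2; have := (fA i).2.
  have := metric_triangle x p (g i); have := metric_triangle p (f i) (g i).
  move=> *; nra.
have := fs _ _ ij; have := (gP i).2; have := (gP j).2.
have := metric_triangle (f i) (g i) (f j); have := metric_triangle (g i) (g j) (f j).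
rewrite (metric_sym (g j) (f j)) => *; nra.
Qed.

(** Otherwise a maximal packing with fewer than [M] points gives a cover by as many sets of diameter
    20 theta r, too few for the ratio (r / 4) / (20 theta r) = 1 / (80 theta). The bound [r <= 4]
    makes the radius [r / 4] admissible. *)
Lemma packed_of_lower_dim_bound (C s theta r : R) M (x : X) :
  (forall (r rho : R) (x : X), 0 < r -> r < rho ->
    (rho%:E <= maxe (diam [set: X]) 1)%E -> [set: X] x ->
    ((C * (rho / r) `^ s)%:E <= cover_number r (cball x rho `&` setT))%E) ->
  0 < theta -> 80 * theta < 1 -> 0 < r -> r <= 4 ->
  M%:R <= C * ((80 * theta)^-1) `^ s ->
  packed (5 * theta * r) (cball x (r / 4)) M.
Proof.
move=> dimX theta0 theta1 r0 r4 MC; apply: contrapT => npacked.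
have thetar0 : 0 < theta * r by rewrite mulr_gt0.
have [|n nM [f [_ _ ballf]]] := packed_maximal _ npacked.
  by rewrite -mulrA mulr_ge0// ltW.
have ncov : covered (20 * theta * r) (cball x (r / 4)) (n * 1).
  apply: covered_bigcup (fun i => cball (f i) (5 * theta * r)) _ _ _ _ => [i|//].
  by apply: covered_cball; lra.
suff : (M%:R : R) <= (n * 1)%:R by rewrite muln1 ler_nat leqNgt nM.
have rhoE : r / 4 / (20 * theta * r) = (80 * theta)^-1 by field; rewrite !gt_eqF.
apply: le_trans MC _; rewrite -lee_fin -rhoE.
apply: le_trans (dimX _ _ x _ _ _ I) (cover_number_le _).
- by rewrite mulr_gt0// mulr_gt0.
- by nra.
- by rewrite le_max !lee_fin orbC ler_pdivrMr// mul1r r4.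
- by rewrite setIT.
Qed.

Lemma covered_of_assouad_dim_bound (C s r rho : R) (x : X) :
  (forall (r rho : R) (x : X), 0 < r -> r < rho -> [set: X] x ->
    (cover_number r (cball x rho `&` setT) <= (C * (rho / r) `^ s)%:E)%E) ->
  0 < r -> r < rho ->
  covered r (cball x rho) (Num.truncn (C * (rho / r) `^ s)).
Proof.
move=> dimX r0 rrho; have [n [ncov nC]] := cover_number_leP (dimX r rho x r0 rrho I).
rewrite setIT in ncov; apply: covered_sub ncov _ _ _ => //.
by rewrite truncn_ge_nat// (le_trans _ nC).
Qed.

Lemma assouad_dim_bound_of_near_separated K (q theta rho0 C s t : R) :
  (forall (r rho : R) (x : X), 0 < r -> r < rho -> [set: X] x ->
    (cover_number r (cball x rho `&` setT) <= (C * (rho / r) `^ s)%:E)%E) ->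
  0 < C -> 0 < q -> q < theta -> theta <= 2^-1 -> 0 < rho0 -> 0 <= t ->
  C * 4 `^ s * (C * (theta / q) `^ s) <= (q^-1) `^ t ->
  (forall n, exists2 A, separated_finite (q ^+ n * rho0 / 2) A &
    mdist A K <= theta * (q ^+ n * rho0)) ->
  assouad_dim_bound K t.
Proof.
move=> dimX C0 q0 qtheta theta2 rho00 t0 qC near.
have q01 : 0 < q < 1 by rewrite q0/=; lra.
have [P [z [zK _ Kz]]] := compact_net K rho00.
(* [M1] bounds the points of the separated set within 2 r of a point, as 4 = 2 r / (r / 2); [M2]
   counts the pieces of size [q * r] covering the [theta * r] ball around each. *)
pose M1 := Num.truncn (C * 4 `^ s); pose M2 := Num.truncn (C * (theta / q) `^ s).
apply: (assouad_dim_bound_of_covering q01 rho00 t0 (M := (M1 * M2)%N) zK Kz).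
  apply: le_trans qC; rewrite natrM ler_pM//.
    by rewrite truncn_le// mulr_ge0 ?powR_ge0// ltW.
  by rewrite truncn_le// mulr_ge0 ?powR_ge0// ltW.
move=> n x Kx; have [A [m [f [-> fs]]] AK] := near n.
have -> : q ^+ n.+1 * rho0 = q * (q ^+ n * rho0) by rewrite exprS mulrA.
set r := q ^+ n * rho0 in fs AK *.
have r0 : 0 < r by rewrite mulr_gt0// exprn_gt0.
have thetar0 : 0 <= theta * r by rewrite mulr_ge0 ?(ltW r0)//; lra.
have [_ KAn] := (mdist_compacts_leP _ K thetar0).1 AK.
(* A point of [K] in the [r] ball around [x] is [theta * r] close to some [f i], which is then
   within [2 * r] of [x]. *)
pose I := {i : 'I_m.+1 | mdist x (f i) <= 2 * r}.
have IM : (#|{: I}| <= M1)%N.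
  have Ip : packed (r / 2) (cball x (2 * r)) #|{: I}|.
    apply: (@packed_fin _ _ _ (fun i : I => f (val i))) => [[]//|i j ij].
    by apply: fs; apply: contra ij => /eqP/val_inj ->.
  apply: packed_covered (lexx _) Ip _; rewrite /M1.
  have -> : 4 = 2 * r / (r / 2) by field; rewrite gt_eqF.
  by apply: covered_of_assouad_dim_bound dimX _ _; lra.
apply: covered_sub (_ : covered (q * r) (cball x r `&` K) (#|{: I}| * M2)) _ _ _ => //.
  have thetaE : theta / q = theta * r / (q * r).
    by field; rewrite !gt_eqF.
  apply: covered_bigcup (fun i : 'I_#|{: I}| => cball (f (val (enum_val i))) (theta * r)) _ _ _ _.
    move=> i; rewrite /M2 thetaE.
    by apply: covered_of_assouad_dim_bound dimX _ _; [exact: mulr_gt0|rewrite ltr_pM2r].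
  move=> y [xy Ky]; have [_ [i _ <-] yi] := KAn y Ky.
  have xi : mdist x (f i) <= 2 * r.
    have := metric_triangle x y (f i); move: xy; rewrite /cball /= => *; nra.
  exists (enum_rank (Sub i xi : I)) => //.
  by rewrite enum_rankK /cball /= metric_sym.
by rewrite leq_mul2r IM orbT.
Qed.

End responses.

(** * The four games on the hyperspace *)

Section games.
Context {R : realType} (X : completeMetricType R).

Let K0 : compacts X := finite_compacts ord0 (fun _ : 'I_1 => (point : X)).

Lemma lower_dim_le s (K : set X) : 0 <= s -> lower_dim_bound K s ->
  (s%:E <= lower_dim K)%E.
Proof. by move=> s0 Ks; apply: ereal_sup_ubound; exists s. Qed.

Lemma lower_dim_gt (s : R) (K : set X) : (s%:E < lower_dim K)%E ->
  exists s', [/\ 0 <= s', s < s' & lower_dim_bound K s'].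
Proof.
move=> /ereal_sup_gt[_ [s' [s'0 Ks'] <-]]; rewrite lte_fin => ss'.
by exists s'.
Qed.

(** The exponent 0 is always admissible, since a nonempty set needs at least one covering set. *)
Lemma lower_dim_ge0 (K : set X) : (0 <= lower_dim K)%E.
Proof.
apply: lower_dim_le => //; exists 1 => // r rho x r0 rrho _ Kx.
rewrite powRr0 mulr1; apply: cover_number_ge => -[|n _]; last by rewrite ler1n.
move=> [U [_ /(_ x)[|[]//]]]; split => //.
by rewrite /cball /= mdistxx ltW// (lt_trans r0).
Qed.

(** For [r > 4] the radius [r / 4] may be inadmissible in the lower dimension bound, so the reply
    leaves the set unchanged. *)
Lemma branching_response (C s theta : R) M :
  (forall (r rho : R) (x : X), 0 < r -> r < rho ->
    (rho%:E <= maxe (diam [set: X]) 1)%E -> [set: X] x ->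
    ((C * (rho / r) `^ s)%:E <= cover_number r (cball x rho `&` setT))%E) ->
  0 < theta -> 80 * theta < 1 -> (0 < M)%N -> M%:R <= C * ((80 * theta)^-1) `^ s ->
  exists f : R -> compacts X -> compacts X, forall r A, 0 < r ->
    mdist A (f r A) <= r / 2 /\
    (r <= 4 -> branching M r (5 * theta * r) (f r A)).
Proof.
move=> dimX theta0 theta1 M0 MC.
apply: (exists_response (P := fun r B => r <= 4 -> branching M r (5 * theta * r) B)).
move=> r A r0; have [r4|r4] := leP r 4; last first.
  by exists A; rewrite mdistxx divr_ge0// ltW.
have [|B [AB Bbr]] := @exists_branching _ _ A M r (5 * theta * r) r0 M0; last by exists B.
move=> x; exact: packed_of_lower_dim_bound MC.
Qed.

Lemma separated_response : exists f : R -> compacts X -> compacts X,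
  forall r A, 0 < r -> mdist A (f r A) <= r / 2 /\ separated_finite (r / 2) (f r A).
Proof.
apply: (exists_response (P := fun r B => separated_finite (r / 2) B)) => r A.
exact: exists_separated_finite.
Qed.

Lemma winning_lower_dim_gt0 :
  uniformly_perfect X -> winning [set K : compacts X | (0 < lower_dim K)%E].
Proof.
move=> /lower_dim_gt[s' [_ s'0 [C C0 dimX]]].
(* Chosen so that two branches are available once 80 alpha <= t; alpha = t / 160 also gives 80 alpha
   < 1. *)
have [t /andP[t0 t1] tC] := exists_powR_ge (2 / C) s'0 (ltr0Sn R 0).
pose alpha := t / 160.
have alpha0 : 0 < alpha by rewrite divr_gt0.
have alpha01 : 0 < alpha < 1 by rewrite alpha0 /alpha; lra.
exists alpha => //; apply: (alpha_winning_response K0 alpha01).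
  exact: compacts_nested_balls.
move=> beta /andP[b0 b1]; pose q := alpha * beta.
have q0 : 0 < q by rewrite mulr_gt0.
have qalpha : q <= alpha by rewrite /q ler_piMr ?ltW.
have alpha80 : 80 * alpha = t / 2 by rewrite /alpha; field.
have MC : 2%:R <= C * ((80 * alpha)^-1) `^ s'.
  rewrite mulrC -ler_pdivrMr// (le_trans tC)//; apply: ge0_ler_powR.
  - exact: ltW.
  - by rewrite nnegrE invr_ge0 ltW.
  - by rewrite nnegrE invr_ge0 mulr_ge0// ltW.
  - by rewrite lef_pV2 ?posrE ?mulr_gt0//; lra.
have alpha1 : 80 * alpha < 1 by rewrite alpha80; lra.
have [f fP] := branching_response dimX alpha0 alpha1 (ltn0Sn 1) MC.
have Q1 : 1 < q^-1 by rewrite invf_gt1//; lra.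
(* The exponent with q^(-s) = 2. *)
pose s := ln 2 / ln q^-1.
have s_gt0 : 0 < s by rewrite divr_gt0 ?ln_gt0// ltr1n.
exists f; split=> [r A r0|r0 K r00 near].
  have := (fP r A r0).1; rewrite /alpha; nra.
(* Bob may open with a large radius; branching is guaranteed only once the radius is at most 4, so
   scales are counted from round [n0]. *)
have [n0 n0r] : exists n, q ^+ n < 4 / r0.
  by apply: exists_expr_lt; [rewrite q0/=; lra|rewrite divr_gt0].
have n0_gt0 : 0 < q ^+ n0 * r0 by rewrite mulr_gt0// exprn_gt0.
apply: (@lt_le_trans _ _ s%:E); first by rewrite lte_fin.
apply: lower_dim_le; first exact: ltW.
apply: (lower_dim_bound_of_near_branching (M := 2) q0 qalpha _ n0_gt0 (ltW s_gt0)).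
- by rewrite /alpha; lra.
- by rewrite powR_ln_div// ltr0n.
move=> n; have nE : q ^+ n * (q ^+ n0 * r0) = q ^+ (n + n0) * r0.
  by rewrite exprD mulrA.
have r_gt0 : 0 < q ^+ (n + n0) * r0 by rewrite mulr_gt0// exprn_gt0.
have [A AK] := near (n + n0)%N; exists (f (q ^+ (n + n0) * r0) A); last by rewrite nE.
rewrite nE; apply: (fP _ _ r_gt0).2.
rewrite -ler_pdivlMr// (le_trans _ (ltW n0r))// exprD ler_piMl ?exprn_ge0 ?(ltW q0)//.
by rewrite exprn_ile1 ?(ltW q0)//; lra.
Qed.

Lemma not_winning_lower_dim_lt (s : R) : (s%:E < lower_dim [set: X])%E ->
  ~ winning [set K : compacts X | (lower_dim K < s%:E)%E].
Proof.
(* For [s < 0] the target set is empty, and Bob can keep Alice's centers. *)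
have [s0|s0] := ltP s 0.
  move=> _; apply: (not_winning_response K0) => alpha _.
  exists 2^-1; first by lra.
  exists (fun _ => id); split=> [r y r0 _|K _ /=]; first by rewrite mdistxx; lra.
  have := lower_dim_ge0 K; move=> /le_lt_trans/[apply]; rewrite lte_fin.
  by rewrite ltNge ltW.
move=> /lower_dim_gt[s' [s'0 ss' [C C0 dimX]]].
apply: (not_winning_response K0) => alpha /andP[a0 a1].
(* Here q^(-s) = (80 / alpha)^s t^(-s), so t^(-(s' - s)) >= L / C yields C t^(-s') >= q^(-s) + 1 >=
   M; the summand 1 pays for rounding [M] up. *)
pose L := (80 / alpha) `^ s + 1.
have ss'0 : 0 < s' - s by rewrite subr_gt0.
have half0 : (0 : R) < 2^-1 by lra.
have [t /andP[t0 t1] tL] := exists_powR_ge (L / C) ss'0 half0.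
pose beta := t / 80; have beta0 : 0 < beta by rewrite divr_gt0.
have beta80 : 80 * beta = t by rewrite /beta; field.
pose q := alpha * beta; have q0 : 0 < q by rewrite mulr_gt0.
have qbeta : q <= beta by rewrite ler_piMl ?ltW.
pose M := (Num.truncn ((q^-1) `^ s)).+1.
have MC : M%:R <= C * ((80 * beta)^-1) `^ s'.
  rewrite beta80 -natr1.
  apply: le_trans (_ : (q^-1) `^ s + 1 <= _).
    by rewrite lerD2r truncn_le// powR_ge0.
  have tV1 : 1 <= t^-1 by rewrite invf_ge1//; lra.
  have t1s : 1 <= (t^-1) `^ s by rewrite -(powRr0 t^-1) ler_powR.
  have -> : q^-1 = 80 / alpha * t^-1.
    by rewrite /q /beta; field; rewrite !gt_eqF.
  have -> : s' = (s' - s) + s by rewrite subrK.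
  rewrite powRD; last by apply/implyP => _; rewrite gt_eqF// invr_gt0.
  rewrite powRM ?invr_ge0 ?(ltW t0)//; last by rewrite divr_ge0// ltW.
  have L0 : 0 <= (80 / alpha) `^ s by exact: powR_ge0.
  move: tL; rewrite ler_pdivrMr// /L => tL; nra.
have beta1 : 80 * beta < 1 by rewrite beta80; lra.
have [f fP] := branching_response dimX beta0 beta1 (ltn0Sn _) MC.
exists beta; first by rewrite beta0/=; lra.
exists f; split=> [r y r0 _|K near].
  have := (fP r y r0).1; nra.
suff : (s%:E <= lower_dim K)%E by rewrite leNgt => /negP.
apply: lower_dim_le => //.
apply: (lower_dim_bound_of_near_branching (M := M) q0 qbeta _ a0 s0).
- by lra.
- exact/ltW/truncnS_gt.
move=> n; have r_gt0 : 0 < q ^+ n * alpha by rewrite mulr_gt0// exprn_gt0.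
have [A AK] := near n; exists (f (q ^+ n * alpha) A) => //.
apply: (fP _ _ r_gt0).2.
have : q ^+ n * alpha <= 1.
  by rewrite mulr_ile1 ?exprn_ge0 ?exprn_ile1 ?(ltW q0) ?(ltW a0) ?(ltW a1)//; lra.
lra.
Qed.

Lemma assouad_dim_le s (K : set X) : 0 <= s -> assouad_dim_bound K s ->
  (assouad_dim K <= s%:E)%E.
Proof. by move=> s0 Ks; apply: ereal_inf_lbound; exists s. Qed.

(** Positive dimension makes alpha^(-s) large for small [alpha]; in dimension 0 the target set would
    be empty. *)
Lemma winning_assouad_dim_lt : assouad_sharp X -> (0 < assouad_dim [set: X])%E ->
  winning [set K : compacts X | (assouad_dim K < assouad_dim [set: X])%E].
Proof.
move=> [dblX]; set s := fine _ => -[C C0 dimX] dim0.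
have sE : assouad_dim [set: X] = s%:E by rewrite fineK// gt0_fin_numE.
have s0 : 0 < s by rewrite -lte_fin -sE.
(* [L] depends only on [X], so [alpha] is fixed before [beta]. *)
pose L := C * 4 `^ s * C; have L0 : 0 < L by rewrite !mulr_gt0// powR_gt0.
have half0 : (0 : R) < 2^-1 by lra.
have [alpha /andP[a0 a2] aL] := exists_powR_ge (L + 1) s0 half0.
have alpha01 : 0 < alpha < 1 by rewrite a0/=; lra.
exists alpha => //; apply: (alpha_winning_response K0 alpha01).
  exact: compacts_nested_balls.
move=> beta /andP[b0 b1]; pose q := alpha * beta.
have q0 : 0 < q by rewrite mulr_gt0.
have qalpha : q < alpha by rewrite gtr_pMr.
have Q1 : 1 < q^-1 by rewrite invf_gt1//; lra.
have [f fP] := separated_response.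
(* The factor beta^(-s) occurs on both sides and cancels, leaving L < alpha^(-s). *)
have LQ : 0 < L * (beta^-1) `^ s < (q^-1) `^ s.
  have bs0 : 0 < (beta^-1) `^ s by rewrite powR_gt0// invr_gt0.
  rewrite mulr_gt0//= /q invfM powRM ?invr_ge0 ?ltW// ltr_pM2r//.
  by apply: lt_le_trans aL; rewrite ltrDl.
have [t /andP[t0 ts] tL] := exists_powR_exponent Q1 s0 LQ.
exists f; split=> [r A r0|r0 K r00 near].
  have := (fP r A r0).1; nra.
rewrite /= sE; apply: (@le_lt_trans _ _ t%:E); last by rewrite lte_fin.
apply: assouad_dim_le => //.
apply: (assouad_dim_bound_of_near_separated dimX C0 q0 qalpha a2 r00 t0).
  have -> : alpha / q = beta^-1 by rewrite /q; field; rewrite !gt_eqF.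
  by rewrite mulrA.
move=> n; have r_gt0 : 0 < q ^+ n * r0 by rewrite mulr_gt0// exprn_gt0.
have [A AK] := near n; exists (f (q ^+ n * r0) A) => //.
exact: (fP _ _ r_gt0).2.
Qed.

Lemma not_winning_assouad_dim_gt (eps : R) : 0 < eps -> doubling X ->
  ~ winning [set K : compacts X | (eps%:E < assouad_dim K)%E].
Proof.
move=> eps0 /ereal_inf_lt[_ [s [s0 [C C0 dimX]] <-] _].
apply: (not_winning_response K0) => alpha /andP[a0 a1].
(* This does not involve [beta], so a small [beta] gives L <= beta^(-eps) <= q^(-eps). *)
pose L := C * 4 `^ s * (C * (alpha^-1) `^ s).
have half0 : (0 : R) < 2^-1 by lra.
have [beta /andP[b0 b2] bL] := exists_powR_ge L eps0 half0.
exists beta; first by rewrite b0/=; lra.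
pose q := alpha * beta; have q0 : 0 < q by rewrite mulr_gt0.
have qbeta : q < beta by rewrite gtr_pMl.
have [f fP] := separated_response.
exists f; split=> [r A r0 _|K near].
  have := (fP r A r0).1; nra.
suff : (assouad_dim K <= eps%:E)%E by rewrite leNgt => /negP.
apply: assouad_dim_le; first exact: ltW.
apply: (assouad_dim_bound_of_near_separated dimX C0 q0 qbeta b2 a0 (ltW eps0)).
  have -> : beta / q = alpha^-1 by rewrite /q; field; rewrite !gt_eqF.
  apply: le_trans bL _; apply: ge0_ler_powR; rewrite ?nnegrE ?invr_ge0 ?(ltW b0) ?(ltW q0) ?(ltW eps0)//.
  by rewrite lef_pV2 ?posrE// ltW.
move=> n; have r_gt0 : 0 < q ^+ n * alpha by rewrite mulr_gt0// exprn_gt0.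
have [A AK] := near n; exists (f (q ^+ n * alpha) A) => //.
exact: (fP _ _ r_gt0).2.
Qed.

End games.

Local Open Scope ereal_scope.

Theorem theorem2p2 (R : realType) (X : completeMetricType R)
    (sepX : separable X) :
  (uniformly_perfect X ->
    winning [set K : compacts X | 0 < lower_dim K]) /\
  ((lower_dim [set: X] < +oo -> forall eps : R, (0 < eps)%R ->
      ~ winning
          [set K : compacts X | lower_dim K < lower_dim [set: X] - eps%:E]) /\
   (lower_dim [set: X] = +oo -> forall s : R,
      ~ winning [set K : compacts X | lower_dim K < s%:E])) /\
  (assouad_sharp X -> 0 < assouad_dim [set: X] ->
    winning [set K : compacts X | assouad_dim K < assouad_dim [set: X]]) /\
  (doubling X -> forall eps : R, (0 < eps)%R ->
    ~ winning [set K : compacts X | eps%:E < assouad_dim K]).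
Proof.
split; first exact: winning_lower_dim_gt0.
split; [split=> [dimoo eps eps0|dimoo s]|split].
(* Finiteness turns the threshold into a real number strictly below the dimension. *)
- have dimE : lower_dim [set: X] = (fine (lower_dim [set: X]))%:E.
    by rewrite fineK// ge0_fin_numE// lower_dim_ge0.
  rewrite dimE -EFinB; apply: not_winning_lower_dim_lt.
  by rewrite dimE lte_fin ltrBlDr ltrDl.
- by apply: not_winning_lower_dim_lt; rewrite dimoo ltry.
- exact: winning_assouad_dim_lt.
- by move=> dblX eps eps0; exact: not_winning_assouad_dim_gt.
Qed.
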